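(* Let $m\ge1$, $\mathcal S\subseteq\{1,\dots,m\}$, $\alpha,a_1,\dots,a_m\in\mathbb{C}^\times$, and $k_1,\dots,k_m\in\mathbb{Z}_{\ge1}$. Then: (1) $E\bigl(\sum_{i=1}^m a_ix_i^{k_i},\mathcal S\bigr)\in\mathcal M_{\mathfrak{sl}(m|1)}\bigl(\prod_{i=1}^mk_i\,\big|\,\prod_{i=1}^mk_i\bigr)$. (2) If $m\ge2$, then for all $\boldsymbol\ell=(\ell_1,\dots,\ell_m)\in(\mathbb{Z}_{\ge0})^m$ and all $p\in\mathbb{Z}_{\ge1}$, $E\bigl(\alpha x_1^{\ell_1}\cdots x_m^{\ell_m},\mathcal S\bigr)\notin\mathcal M_{\mathfrak{sl}(m|1)}(p|p)$.
   Context: Everything is over $\mathbb{C}$. Index rows and columns of $(m+1)\times(m+1)$ matrices by $1,\dots,m,\bar 1$, with matrix units $e_{pq}$. The Lie superalgebra $\mathfrak{sl}(m|1)$ is spanned by the even elements $h_i:=e_{ii}+e_{\bar1\bar1}$ ($1\le i\le m$), $e_{ij}$ ($1\le i\ne j\le m$) and the odd elements $e_{i\bar1},e_{\bar1 i}$ ($1\le i\le m$), with bracket $[u,v]=uv-(-1)^{\bar u\bar v}vu$. Let $\mathfrak h=\operatorname{Span}\{h_1,\dots,h_m\}$, so $\mathcal U(\mathfrak h)=\mathbb{C}[h_1,\dots,h_m]$. For $k\ge1$, $\mathcal M_{\mathfrak{sl}(m|1)}(k|k)$ is the full subcategory of $\mathcal U(\mathfrak{sl}(m|1))$-modules consisting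 of $\mathbb{Z}_2$-graded modules $M=M_{\bar0}\oplus M_{\bar1}$ such that $M_{\bar0}$ and $M_{\bar1}$ are each free of rank $k$ as $\mathcal U(\mathfrak h)$-modules. Exponential modules. For $g\in\mathbb{C}[x_1,\dots,x_m]$ and $\mathcal S\subseteq\{1,\dots,m\}$, $E(g,\mathcal S)$ is the vector space $\mathbb{C}[x_1,\dots,x_m,\xi]\,e^{g}=\mathbb{C}[x_1,\dots,x_m]e^g\oplus\mathbb{C}[x_1,\dots,x_m]\xi e^g$ ($\xi$ odd, $\xi^2=0$; the first summand is even, the second odd). For $f\in\mathbb{C}[x_1,\dots,x_m]$, $\varepsilon\in\{0,1\}$, define operators on it: $x_i$ acts by multiplication; $\partial_{x_i}(f\xi^\varepsilon e^g)=\bigl(\frac{\partial f}{\partial x_i}+f\frac{\partial g}{\partial x_i}\bigr)\xi^\varepsilon e^g$; $\xi\cdot(f\xi^\varepsilon e^g)=(1-\varepsilon)f\xi e^g$; $\partial_\xi(f\xi^\varepsilon e^g)=\varepsilon f e^g$. The $\mathfrak{sl}(m|1)$-action is: $h_i\mapsto x_i\partial_{x_i}+\xi\partial_\xi$ if $i\notin\mathcal S$ and $h_i\mapsto -x_i\partial_{x_i}-1+\xi\partial_\xi$ if $i\in\mathcal S$; for $i\neq j$, $e_{ij}\mapsto x_i\partial_{x_j}$ ($i,j\notin\mathcal S$), $\partial_{x_i}\partial_{x_j}$ ($i\in\mathcal S,j\notin\mathcal S$), $-x_ix_j$ ($i\notin\mathcal S,j\in\mathcal S$), $-x_j\partial_{x_i}$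 ($i,j\in\mathcal S$); $e_{i\bar1}\mapsto x_i\partial_\xi$ ($i\notin\mathcal S$), $\partial_{x_i}\partial_\xi$ ($i\in\mathcal S$); $e_{\bar1 i}\mapsto \xi\partial_{x_i}$ ($i\notin\mathcal S$), $-x_i\xi$ ($i\in\mathcal S$). *)

(* Defs.v *)
From HB Require Import structures.
From mathcomp Require Import all_boot all_order all_algebra.
From mathcomp Require Import mpoly.
Set Implicit Arguments.
Unset Strict Implicit.
Unset Printing Implicit Defensive.
Import GRing.Theory.
Local Open Scope ring_scope.

Section SpecialLinear.
Context {F : fieldType} {m : nat}.

(* 'I_(m + 1) is the index set {1, ..., m, \bar 1}. *)
Definition ix (i : 'I_m) : 'I_(m + 1) := lshift 1 i.
Definition bar : 'I_(m + 1) := rshift m ord0.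

Definition parity (p : 'I_(m + 1)) : bool := p == bar.

Definition hmx (i : 'I_m) : 'M[F]_(m + 1) :=
  delta_mx (ix i) (ix i) + delta_mx bar bar.

Definition sl : {vspace 'M[F]_(m + 1)} :=
  (\sum_i <[hmx i]>
   + \sum_i \sum_(j | j != i) <[delta_mx (ix i) (ix j)]>
   + \sum_i <[delta_mx (ix i) bar]>
   + \sum_i <[delta_mx bar (ix i)]>)%VS.

Definition is_homog (a : bool) (A : 'M[F]_(m + 1)) : Prop :=
  forall p q, A p q != 0 -> parity p (+) parity q = a.

Definition hcomp (a : bool) (A : 'M[F]_(m + 1)) : 'M[F]_(m + 1) :=
  \matrix_(p, q) (if parity p (+) parity q == a then A p q else 0).

(* Bilinear extension of [A, B] = A B - (-1)^{|A||B|} B A; hcomp takes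
   homogeneous components. *)
Definition sbracket (A B : 'M[F]_(m + 1)) : 'M[F]_(m + 1) :=
  \sum_(a : bool) \sum_(b : bool)
    (hcomp a A *m hcomp b B
     - (-1) ^+ (a && b) *: (hcomp b B *m hcomp a A)).

(* vsproj only casts into the subspace type: sl is closed under sbracket
   (see slbrE). *)
Definition slbr (u v : subvs_of sl) : subvs_of sl :=
  vsproj sl (sbracket (vsval u) (vsval v)).

Definition slh (i : 'I_m) : subvs_of sl := vsproj sl (hmx i).

Lemma parity_ix i : parity (ix i) = false.
Proof. by rewrite /parity /ix /bar eq_lrshift. Qed.

Lemma parity_bar : parity bar.
Proof. by rewrite /parity eqxx. Qed.

Lemma ixP (p : 'I_(m + 1)) : (exists i, p = ix i) \/ p = bar.
Proof.
case: (splitP p) => [i hi|j hj].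
  by left; exists i; apply: val_inj.
by right; apply: val_inj; rewrite /= hj ord1.
Qed.

Lemma sum_ix (V : nmodType) (f : 'I_(m + 1) -> V) :
  \sum_p f p = \sum_i f (ix i) + f bar.
Proof. by rewrite big_split_ord /= big_ord1. Qed.

Lemma sl_decomp (A : 'M[F]_(m + 1)) : A bar bar = \sum_i A (ix i) (ix i) ->
  A = \sum_i A (ix i) (ix i) *: hmx i
      + \sum_i \sum_(j | j != i) A (ix i) (ix j) *: delta_mx (ix i) (ix j)
      + \sum_i A (ix i) bar *: delta_mx (ix i) bar
      + \sum_i A bar (ix i) *: delta_mx bar (ix i).
Proof.
move=> hA; rewrite {1}(matrix_sum_delta A) sum_ix sum_ix hA.
rewrite (eq_bigr (fun i : 'I_m =>
    (A (ix i) (ix i) *: delta_mx (ix i) (ix i)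
     + \sum_(j | j != i) A (ix i) (ix j) *: delta_mx (ix i) (ix j))
    + A (ix i) bar *: delta_mx (ix i) bar)); last first.
  by move=> i _; rewrite sum_ix (bigD1 i).
rewrite !big_split /=; under [in RHS]eq_bigr do rewrite /hmx scalerDr.
rewrite big_split /= -scaler_suml -!addrA; congr (_ + _).
by rewrite [RHS]addrC -!addrA.
Qed.

Lemma mem_sl (A : 'M[F]_(m + 1)) :
  (A \in sl) = (A bar bar == \sum_i A (ix i) (ix i)).
Proof.
apply/idP/eqP => [hA|/sl_decomp ->]; last first.
  rewrite /sl !memv_add //; apply: memv_sumr => i _.
  - by rewrite memvZ ?memv_line.
  - by apply: memv_sumr => j _; rewrite memvZ ?memv_line.
  - by rewrite memvZ ?memv_line.
  - by rewrite memvZ ?memv_line.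
pose f (B : 'M[F]_(m + 1)) : F^o := B bar bar - \sum_i B (ix i) (ix i).
have fL : linear f.
  move=> c B D; rewrite /f !mxE; under eq_bigr do rewrite !mxE.
  rewrite big_split /= -mulr_sumr opprD addrACA; congr (_ + _).
  exact: (esym (mulrBr c _ _)).
pose fB := GRing.isLinear.Build F _ _ _ f fL.
pose g : {linear 'M[F]_(m + 1) -> F^o} := HB.pack f fB.
suff : A \in lker (linfun g).
  by rewrite memv_ker lfunE /= subr_eq0 => /eqP.
have d p q (i j : 'I_m) : delta_mx p q (ix i) (ix j) =
   ((p == ix i) && (q == ix j))%:R :> F by rewrite mxE eq_sym [_ == q]eq_sym.
have nb i : (bar == ix i) = false by rewrite eq_sym -[LHS]/(parity (ix i)) parity_ix.
have nb' i : (ix i == bar) = false by rewrite eq_sym nb.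
have inj i j : (ix i == ix j) = (i == j) by rewrite /ix eq_lshift.
apply: subvP hA; rewrite /sl !subv_add -!andbA; apply/and4P; split;
  apply/subv_sumP => i _.
- rewrite -memvE memv_ker lfunE /= /f /hmx !mxE !eqxx !nb add0r subr_eq0.
  rewrite (bigD1 i) //= big1 => [|j ji]; rewrite !mxE ?nb' ?inj.
    by rewrite !eqxx !addr0.
  by rewrite (negbTE ji) addr0.
- apply/subv_sumP => j ji; rewrite -memvE memv_ker lfunE /= /f mxE !nb sub0r.
  rewrite oppr_eq0 big1 // => k _; rewrite d !inj.
  by case: eqP => // <-; rewrite (negbTE ji).
- rewrite -memvE memv_ker lfunE /= /f mxE !nb sub0r.
  by rewrite oppr_eq0 big1 // => k _; rewrite d nb andbF.
- rewrite -memvE memv_ker lfunE /= /f mxE !nb andbF sub0r.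
  by rewrite oppr_eq0 big1 // => k _; rewrite d nb.
Qed.

Lemma hcomp_homog a b A :
  is_homog a A -> hcomp b A = if b == a then A else 0.
Proof.
move=> hA; apply/matrixP => p q; rewrite mxE.
have [z|/hA ->] := eqVneq (A p q) 0.
  by rewrite z if_same; case: ifP; rewrite ?z ?mxE.
by rewrite eq_sym; case: ifP; rewrite ?mxE.
Qed.

Lemma sbracket_homog a b A B : is_homog a A -> is_homog b B ->
  sbracket A B = A *m B - (-1) ^+ (a && b) *: (B *m A).
Proof.
move=> hA hB; rewrite /sbracket (bigD1 a) //= [X in _ + X]big1 ?addr0.
  rewrite (bigD1 b) //= [X in _ + X]big1 ?addr0.
    by rewrite !(hcomp_homog _ hA) !(hcomp_homog _ hB) !eqxx.
  move=> b' nb; rewrite !(hcomp_homog _ hB) (negbTE nb).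
  by rewrite mulmx0 mul0mx scaler0 subr0.
move=> a' na; apply: big1 => b' _; rewrite !(hcomp_homog _ hA) (negbTE na).
by rewrite mulmx0 mul0mx scaler0 subr0.
Qed.

Lemma sbracket_sl A B : A \in sl -> B \in sl -> sbracket A B \in sl.
Proof.
move=> _ _; rewrite /sbracket; apply: memv_suml => a _; apply: memv_suml => b _.
rewrite mem_sl; set A' := hcomp a A; set B' := hcomp b B.
have nb i : (bar == ix i) = false by rewrite eq_sym -[LHS]/(parity (ix i)) parity_ix.
pose s (p : 'I_(m + 1)) : F := (-1) ^+ (parity p).
suff : \sum_p s p * (A' *m B' - (-1) ^+ (a && b) *: (B' *m A')) p p = 0.
  rewrite sum_ix /s parity_bar mulN1r; under eq_bigr do rewrite parity_ix mul1r.
  by move/eqP; rewrite subr_eq0 => /eqP ->.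
under eq_bigr do rewrite !mxE mulrBr.
rewrite big_split /= sumrN; apply/eqP; rewrite subr_eq0; apply/eqP.
under eq_bigr do rewrite mulr_sumr.
rewrite exchange_big; apply: eq_bigr => q _ /=; rewrite !mulr_sumr.
apply: eq_bigr => p _; rewrite !mxE /s.
case: eqP => [<-|_]; last by rewrite !(mul0r, mulr0).
case: eqP => [<-|_]; last by rewrite !(mul0r, mulr0).
rewrite [B q p * _]mulrC; case: (parity p); case: (parity q) => /=;
  by rewrite !(expr0, expr1, mul1r, mulN1r, opprK).
Qed.

Lemma slbrE u v : vsval (slbr u v) = sbracket (vsval u) (vsval v).
Proof. by rewrite vsprojK // sbracket_sl // subvsP. Qed.

Lemma slhE i : vsval (slh i) = hmx i.
Proof.
rewrite vsprojK // /sl -!addvA; apply: subvP (addvSl _ _) _ _.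
by rewrite -[hmx i]addr0 (bigD1 i) //= memv_add ?memv_line ?mem0v.
Qed.

End SpecialLinear.

Arguments sl F m : clear implicits.

Section Modules.
Context {F : fieldType} {m : nat}.

Definition in_part (V0 V1 : lmodType F) (b : bool) (x : V0 * V1) : Prop :=
  if b then x.1 = 0 else x.2 = 0.

(* A Z/2-graded U(sl(m|1))-module M = M_0 (+) M_1, given by the equivalent data
   of a representation of the Lie superalgebra sl(m|1). *)
Record slmod := SlMod {
  mod0 : lmodType F;
  mod1 : lmodType F;
  act : subvs_of (sl F m) -> mod0 * mod1 -> mod0 * mod1;
  act_linearl : forall c u v x, act (c *: u + v) x = c *: act u x + act v x;
  act_linearr : forall u c x y, act u (c *: x + y) = c *: act u x + act u y;
  act_parity : forall a b u x, is_homog a (vsval u) -> in_part b x ->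
    in_part (a (+) b) (act u x);
  act_bracket : forall a b u v x, is_homog a (vsval u) -> is_homog b (vsval v) ->
    act (slbr u v) x
    = act u (act v x) - (-1) ^+ (a && b) *: act v (act u x)
}.

(* The action of p(h_1, ..., h_m) in U(h) = F[h_1, ..., h_m]. *)
Definition uh_act (M : slmod) (p : {mpoly F[m]}) (x : mod0 M * mod1 M)
    : mod0 M * mod1 M :=
  \sum_(mu <- msupp p)
    p@_mu *: foldr (fun i y => iter (mu i) (act (slh i)) y) x (enum 'I_m).

Definition uh_free (M : slmod) (b : bool) (k : nat) : Prop :=
  exists e : 'I_k -> mod0 M * mod1 M,
    (forall j, in_part b (e j)) /\
    (forall x, in_part b x ->
       exists! c : {ffun 'I_k -> {mpoly F[m]}}, x = \sum_j uh_act (c j) (e j)).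

(* Membership in the full subcategory M_{sl(m|1)}(k|k), for k >= 1. *)
Definition inMsl (k : nat) (M : slmod) : Prop :=
  uh_free M false k /\ uh_free M true k.

End Modules.

Arguments slmod F m : clear implicits.

Section Exponential.
Context {F : fieldType} {m : nat}.
Variables (g : {mpoly F[m]}) (S : {set 'I_m}).

(* The pair (f0, f1) stands for f0 e^g + f1 \xi e^g. *)
Local Notation E := ({mpoly F[m]} * {mpoly F[m]})%type.

Definition mulx (i : 'I_m) (w : E) : E := ('X_i * w.1, 'X_i * w.2).
Definition dx (i : 'I_m) (w : E) : E :=
  (w.1^`M(i) + w.1 * g^`M(i), w.2^`M(i) + w.2 * g^`M(i)).
Definition mulxi (w : E) : E := (0, w.1).
Definition dxi (w : E) : E := (w.2, 0).

Definition Eh (i : 'I_m) (w : E) : E :=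
  if i \in S then - mulx i (dx i w) - w + mulxi (dxi w)
  else mulx i (dx i w) + mulxi (dxi w).

(* The action of e_{ij}, for i != j. *)
Definition Ee (i j : 'I_m) (w : E) : E :=
  match i \in S, j \in S with
  | false, false => mulx i (dx j w)
  | true, false => dx i (dx j w)
  | false, true => - mulx i (mulx j w)
  | true, true => - mulx j (dx i w)
  end.

(* The action of e_{i \bar 1}. *)
Definition Ee_bar (i : 'I_m) (w : E) : E :=
  if i \in S then dx i (dxi w) else mulx i (dxi w).

(* The action of e_{\bar 1 i}. *)
Definition Ebar_e (i : 'I_m) (w : E) : E :=
  if i \in S then - mulx i (mulxi w) else mulxi (dx i w).

(* The linear extension of the formulas above: by sl_decomp, the entries of u
   used here are its coordinates in the basis of sl(m|1). *)
Definition Eact (u : subvs_of (sl F m)) (w : E) : E :=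
  let A := vsval u in
  \sum_i A (ix i) (ix i) *: Eh i w
  + \sum_i \sum_(j | j != i) A (ix i) (ix j) *: Ee i j w
  + \sum_i A (ix i) bar *: Ee_bar i w
  + \sum_i A bar (ix i) *: Ebar_e i w.

(* Uniformly, e_{pq} acts by opX p \o opD q, where opX and opD satisfy the
   relations of a Weyl superalgebra. *)
Definition opX (p : 'I_(m + 1)) (w : E) : E :=
  match split p with
  | inl i => if i \in S then dx i w else mulx i w
  | inr _ => mulxi w
  end.
Definition opD (p : 'I_(m + 1)) (w : E) : E :=
  match split p with
  | inl i => if i \in S then - mulx i w else dx i w
  | inr _ => dxi w
  end.

Lemma opX_ix i w : opX (ix i) w = if i \in S then dx i w else mulx i w.
Proof. by rewrite /opX /ix (unsplitK (inl _ i)). Qed.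
Lemma opX_bar w : opX bar w = mulxi w.
Proof. by rewrite /opX /bar (unsplitK (inr _ _)). Qed.
Lemma opD_ix i w : opD (ix i) w = if i \in S then - mulx i w else dx i w.
Proof. by rewrite /opD /ix (unsplitK (inl _ i)). Qed.
Lemma opD_bar w : opD bar w = dxi w.
Proof. by rewrite /opD /bar (unsplitK (inr _ _)). Qed.

Lemma pairE (A B : Type) (x y : A * B) : x.1 = y.1 -> x.2 = y.2 -> x = y.
Proof. by case: x y => [? ?] [? ?] /= -> ->. Qed.

Lemma mulx_linear i : linear (mulx i).
Proof.
by move=> c x y; apply: pairE; rewrite /= mulrDr -scalerAr.
Qed.
HB.instance Definition _ i := GRing.isLinear.Build F E E *:%R (mulx i) (mulx_linear i).
Lemma dx_linear i : linear (dx i).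
Proof.
by move=> c x y; apply: pairE;
   rewrite /= mderivD mderivZ mulrDl -scalerAl scalerDr addrACA.
Qed.
HB.instance Definition _ i := GRing.isLinear.Build F E E *:%R (dx i) (dx_linear i).
Lemma mulxi_linear : linear mulxi.
Proof. by move=> c x y; apply: pairE; rewrite //= scaler0 addr0. Qed.
HB.instance Definition _ := GRing.isLinear.Build F E E *:%R mulxi mulxi_linear.
Lemma dxi_linear : linear dxi.
Proof. by move=> c x y; apply: pairE; rewrite //= scaler0 addr0. Qed.
HB.instance Definition _ := GRing.isLinear.Build F E E *:%R dxi dxi_linear.

Lemma opX_linear p : linear (opX p).
Proof.
move=> c x y; case: (ixP p) => [[i ->]|->]; last by rewrite !opX_bar linearP.
by rewrite !opX_ix; case: ifP => _; rewrite linearP.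
Qed.
HB.instance Definition _ p := GRing.isLinear.Build F E E *:%R (opX p) (opX_linear p).
Lemma opD_linear p : linear (opD p).
Proof.
move=> c x y; case: (ixP p) => [[i ->]|->]; last by rewrite !opD_bar linearP.
by rewrite !opD_ix; case: ifP => _; rewrite linearP // opprD scalerN.
Qed.
HB.instance Definition _ p := GRing.isLinear.Build F E E *:%R (opD p) (opD_linear p).

Lemma mulxC i j w : mulx i (mulx j w) = mulx j (mulx i w).
Proof. by apply: pairE; rewrite /= mulrCA. Qed.

Lemma mderivXi (i j : 'I_m) : ('X_j : {mpoly F[m]})^`M(i) = (i == j)%:R.
Proof.
rewrite mderivX mnm1E eq_sym; case: eqP => [->|_]; last by rewrite scale0r.
by rewrite -[X in (X - _)%MM]add0m addmK mpolyX0 scale1r.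
Qed.

Lemma dx_mulx i j w : dx i (mulx j w) = (i == j)%:R *: w + mulx j (dx i w).
Proof.
by apply: pairE; rewrite /= mderivM mderivXi; case: (i == j);
   rewrite ?scale1r ?scale0r ?mul1r ?mul0r mulrDr mulrA addrA.
Qed.

Lemma dxC i j w : dx i (dx j w) = dx j (dx i w).
Proof.
have H (f : {mpoly F[m]}) :
  (f^`M(j) + f * g^`M(j))^`M(i) + (f^`M(j) + f * g^`M(j)) * g^`M(i)
  = (f^`M(i) + f * g^`M(i))^`M(j) + (f^`M(i) + f * g^`M(i)) * g^`M(j).
  rewrite !mderivD !mderivM !mulrDl (mderiv_comm _ _ f) (mderiv_comm _ _ g).
  rewrite -!addrA; congr (_ + _).
  rewrite [f * g^`M(j) * _]mulrAC !addrA; congr (_ + _).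
  by rewrite addrAC [RHS]addrAC [_ + f^`M(j) * _]addrC.
by apply: pairE; apply: H.
Qed.

Lemma EactE u w :
  Eact u w = \sum_p \sum_q (vsval u) p q *: opX p (opD q w).
Proof.
rewrite /Eact; set A := vsval u.
have hA : A bar bar = \sum_i A (ix i) (ix i).
  by apply/eqP; rewrite -mem_sl subvsP.
rewrite sum_ix sum_ix hA.
rewrite [X in _ = X + _](eq_bigr (fun i : 'I_m => A (ix i) (ix i) *: (Eh i w - mulxi (dxi w))
     + \sum_(j | j != i) A (ix i) (ix j) *: Ee i j w
    + A (ix i) bar *: Ee_bar i w)); last first.
  move=> i _; rewrite sum_ix (bigD1 i) //=; congr (_ + _ + _).
  - rewrite opX_ix opD_ix /Eh; case: (i \in S); rewrite addrK //.
    by rewrite linearN /= dx_mulx eqxx scale1r opprD addrC.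
  - apply: eq_bigr => j ji; rewrite opX_ix opD_ix /Ee.
    case iS: (i \in S); case jS: (j \in S) => /=; rewrite ?linearN //=.
    by rewrite dx_mulx eq_sym (negbTE ji) scale0r add0r.
  - by rewrite opX_ix opD_bar /Ee_bar.
have -> : \sum_i A bar (ix i) *: opX bar (opD (ix i) w)
        = \sum_i A bar (ix i) *: Ebar_e i w.
  apply: eq_bigr => i _; rewrite opX_bar opD_ix /Ebar_e; case: (i \in S) => //.
  rewrite linearN; congr (_ *: - _).
  by apply: pairE; rewrite /= ?mulr0.
rewrite opX_bar opD_bar !big_split /=.
under [\sum_i _ *: (_ - _)]eq_bigr do rewrite scalerBr.
rewrite sumrB -scaler_suml.
set T := (\sum_i _) *: mulxi _; rewrite -!addrA; congr (_ + _).
by rewrite [RHS]addrC -!addrA subrr addr0.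
Qed.

Lemma opXX p r w :
  opX p (opX r w) = (-1) ^+ (parity p && parity r) *: opX r (opX p w).
Proof.
case: (ixP p) => [[i ->]|->]; case: (ixP r) => [[j ->]|->];
  rewrite ?parity_ix ?parity_bar /= ?scale1r ?opX_ix ?opX_bar.
- case iS: (i \in S); case jS: (j \in S) => /=; rewrite ?[dx i (dx _ _)]dxC //.
  + by rewrite dx_mulx; case: eqP iS jS => [->->//|]; rewrite scale0r add0r.
  + rewrite dx_mulx eq_sym.
    by case: eqP iS jS => [->->//|]; rewrite scale0r add0r.
  + exact: mulxC.
- by case: (_ \in S); apply: pairE; rewrite //= ?mulr0 ?mul0r ?linear0 ?addr0.
- by case: (_ \in S); apply: pairE; rewrite //= ?mulr0 ?mul0r ?linear0 ?addr0.
- by apply: pairE; rewrite //= ?scaler0.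
Qed.

Lemma opDD p r w :
  opD p (opD r w) = (-1) ^+ (parity p && parity r) *: opD r (opD p w).
Proof.
case: (ixP p) => [[i ->]|->]; case: (ixP r) => [[j ->]|->];
  rewrite ?parity_ix ?parity_bar /= ?scale1r ?opD_ix ?opD_bar.
- case iS: (i \in S); case jS: (j \in S) => /=; rewrite ?linearN /= ?[dx i (dx _ _)]dxC //.
  + by rewrite mulxC.
  + rewrite dx_mulx eq_sym.
    by case: eqP iS jS => [->->//|]; rewrite scale0r add0r.
  + by rewrite dx_mulx; case: eqP iS jS => [->->//|]; rewrite scale0r add0r.
- by case: (_ \in S); apply: pairE;
     rewrite //= ?mulr0 ?mul0r ?linear0 ?addr0 ?oppr0.
- by case: (_ \in S); apply: pairE;
     rewrite //= ?mulr0 ?mul0r ?linear0 ?addr0 ?oppr0.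
- by apply: pairE; rewrite //= ?scaler0.
Qed.

Lemma opDX q r w : opD q (opX r w) =
  (q == r)%:R *: w + (-1) ^+ (parity q && parity r) *: opX r (opD q w).
Proof.
have nb (i : 'I_m) : (bar == ix i) = false.
  by rewrite eq_sym -[LHS]/(parity (ix i)) parity_ix.
have nb' (i : 'I_m) : (ix i == bar) = false by rewrite eq_sym nb.
case: (ixP q) => [[i ->]|->]; case: (ixP r) => [[j ->]|->];
  rewrite ?parity_ix ?parity_bar ?nb ?nb' /= ?scale0r ?add0r ?scale1r
    ?opX_ix ?opX_bar ?opD_ix ?opD_bar.
- rewrite /ix eq_lshift.
  case iS: (i \in S); case jS: (j \in S) => /=; rewrite ?linearN /=.
  + by rewrite dx_mulx eq_sym opprD addrA subrr sub0r.
  + by rewrite mulxC; case: eqP iS jS => [->->//|]; rewrite scale0r add0r.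
  + by rewrite dxC; case: eqP iS jS => [->->//|]; rewrite scale0r add0r.
  + exact: dx_mulx.
- by case: (_ \in S); apply: pairE;
     rewrite //= ?mulr0 ?mul0r ?linear0 ?addr0 ?oppr0.
- by case: (_ \in S); apply: pairE;
     rewrite //= ?mulr0 ?mul0r ?linear0 ?addr0 ?oppr0.
- by rewrite eqxx scale1r; apply: pairE; rewrite //= ?scaleN1r ?subr0 ?subrr.
Qed.

Lemma Eact_linearl c u v w : Eact (c *: u + v) w = c *: Eact u w + Eact v w.
Proof.
rewrite !EactE scaler_sumr -big_split; apply: eq_bigr => p _ /=.
rewrite scaler_sumr -big_split; apply: eq_bigr => q _ /=.
by rewrite !mxE scalerDl scalerA.
Qed.

Lemma Eact_linearr u c x y : Eact u (c *: x + y) = c *: Eact u x + Eact u y.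
Proof.
rewrite !EactE scaler_sumr -big_split; apply: eq_bigr => p _ /=.
rewrite scaler_sumr -big_split; apply: eq_bigr => q _ /=.
by rewrite [opD q _]linearP [opX p _]linearP scalerDr !scalerA [c * _]mulrC.
Qed.

Lemma opX_part p b (w : E) : in_part b w -> in_part (parity p (+) b) (opX p w).
Proof.
case: (ixP p) => [[i ->]|->]; rewrite ?parity_ix ?parity_bar ?opX_ix ?opX_bar.
  by case: (i \in S); case: b; rewrite /in_part /dx /mulx /= => ->;
     rewrite ?mulr0 ?mul0r ?linear0 ?addr0.
by case: b; rewrite /in_part /= => // ->.
Qed.

Lemma opD_part p b (w : E) : in_part b w -> in_part (parity p (+) b) (opD p w).
Proof.
case: (ixP p) => [[i ->]|->]; rewrite ?parity_ix ?parity_bar ?opD_ix ?opD_bar.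
  by case: (i \in S); case: b; rewrite /in_part /dx /mulx /= => ->;
     rewrite ?mulr0 ?mul0r ?linear0 ?addr0 ?oppr0.
by case: b; rewrite /in_part /= => // ->.
Qed.

Lemma in_part_sum (V0 V1 : lmodType F) b (I : Type) (r : seq I) (P : pred I)
    (f : I -> V0 * V1) :
  (forall i, P i -> in_part b (f i)) -> in_part b (\sum_(i <- r | P i) f i).
Proof.
move=> h; apply: (big_ind (in_part b)) => //; first by case: b {h}.
by case: b {h} => x y /= -> ->; rewrite addr0.
Qed.

Lemma Eact_parity a b u (w : E) : is_homog a (vsval u) -> in_part b w ->
  in_part (a (+) b) (Eact u w).
Proof.
move=> hu hw; rewrite EactE; apply: in_part_sum => p _.
apply: in_part_sum => q _; have [->|/hu <-] := eqVneq (vsval u p q) 0.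
  by rewrite scale0r; case: (_ (+) _).
have := opX_part p (opD_part q hw); rewrite addbA.
by case: (_ (+) b) => /= ->; rewrite scaler0.
Qed.

Lemma Eact_bracket a b u v w :
  is_homog a (vsval u) -> is_homog b (vsval v) ->
  Eact (slbr u v) w
  = Eact u (Eact v w) - (-1) ^+ (a && b) *: Eact v (Eact u w).
Proof.
move=> hu hv; rewrite !EactE slbrE (sbracket_homog hu hv).
have comp (A B : 'M[F]_(m + 1)) :
    \sum_p \sum_q A p q *: opX p (opD q
       (\sum_r \sum_s B r s *: opX r (opD s w)))
  = \sum_p \sum_q \sum_r \sum_s
      (A p q * B r s) *: opX p (opD q (opX r (opD s w))).
  apply: eq_bigr => p _; apply: eq_bigr => q _.
  rewrite 2!linear_sum scaler_sumr; apply: eq_bigr => r _.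
  rewrite 2!linear_sum scaler_sumr; apply: eq_bigr => s _.
  by rewrite 2!linearZ scalerA.
rewrite !comp; set A := vsval u; set B := vsval v.
have swap : \sum_p \sum_q \sum_r \sum_s
      (B p q * A r s) *: opX p (opD q (opX r (opD s w)))
  = \sum_p \sum_q \sum_r \sum_s
      (A p q * B r s) *: opX r (opD s (opX p (opD q w))).
  transitivity (\sum_p \sum_r \sum_q \sum_s
      (B p q * A r s) *: opX p (opD q (opX r (opD s w)))).
    by apply: eq_bigr => p _; rewrite exchange_big.
  rewrite exchange_big; apply: eq_bigr => r _ /=.
  transitivity (\sum_p \sum_s \sum_q
      (B p q * A r s) *: opX p (opD q (opX r (opD s w)))).
    by apply: eq_bigr => p _; rewrite exchange_big.
  rewrite exchange_big; apply: eq_bigr => s _ /=.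
  by apply: eq_bigr => p _; apply: eq_bigr => q _; rewrite mulrC.
rewrite swap.
have prod (C D : 'M[F]_(m + 1)) :
    \sum_p \sum_s (C *m D) p s *: opX p (opD s w)
  = \sum_p \sum_q \sum_r \sum_s
      (C p q * D r s) *: ((q == r)%:R *: opX p (opD s w)).
  apply: eq_bigr => p _; under eq_bigr do rewrite mxE scaler_suml.
  rewrite exchange_big; apply: eq_bigr => q _ /=.
  rewrite [RHS](bigD1 q) //= [X in _ = _ + X]big1 ?addr0.
    by apply: eq_bigr => s _; rewrite eqxx scale1r.
  move=> r rq; apply: big1 => s _.
  by rewrite eq_sym (negbTE rq) scale0r scaler0.
transitivity (\sum_p \sum_s (A *m B) p s *: opX p (opD s w)
   - (-1) ^+ (a && b) *: \sum_p \sum_s (B *m A) p s *: opX p (opD s w)).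
  rewrite scaler_sumr -sumrB; apply: eq_bigr => p _.
  rewrite scaler_sumr -sumrB; apply: eq_bigr => s _.
  by rewrite !mxE scalerA -scalerBl.
have prod' : \sum_p \sum_s (B *m A) p s *: opX p (opD s w)
  = \sum_p \sum_q \sum_r \sum_s
      (A p q * B r s) *: ((s == p)%:R *: opX r (opD q w)).
  rewrite prod.
  transitivity (\sum_p \sum_r \sum_q \sum_s
      (B p q * A r s) *: ((q == r)%:R *: opX p (opD s w))).
    by apply: eq_bigr => p _; rewrite exchange_big.
  rewrite exchange_big; apply: eq_bigr => r _ /=.
  transitivity (\sum_p \sum_s \sum_q
      (B p q * A r s) *: ((q == r)%:R *: opX p (opD s w))).
    by apply: eq_bigr => p _; rewrite exchange_big.
  rewrite exchange_big; apply: eq_bigr => s _ /=.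
  by apply: eq_bigr => p _; apply: eq_bigr => q _; rewrite mulrC.
rewrite prod prod' !scaler_sumr -!sumrB; apply: eq_bigr => p _.
rewrite !scaler_sumr -!sumrB; apply: eq_bigr => q _.
rewrite !scaler_sumr -!sumrB; apply: eq_bigr => r _.
rewrite !scaler_sumr -!sumrB; apply: eq_bigr => s _.
have [z|/hu ha] := eqVneq (A p q) 0.
  by rewrite z mul0r !scale0r !scaler0.
have [z|/hv hb] := eqVneq (B r s) 0.
  by rewrite z mulr0 !scale0r !scaler0.
set c := A p q * B r s; set e : F := (-1) ^+ (a && b).
have cC (x : E) : e *: (c *: x) = c *: (e *: x) by rewrite !scalerA mulrC.
rewrite !cC -!scalerBr !opDX; congr (_ *: _).
have ZD n (y z : E) d t :
    opX n (d *: y + t *: z) = d *: opX n y + t *: opX n z.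
  by rewrite linearD !linearZ.
have Z n d (y : E) : opX n (d *: y) = d *: opX n y by rewrite linearZ.
rewrite !ZD opXX (opDD q s) !Z (scalerDr e) !scalerA opprD.
rewrite [RHS]addrACA [X in _ = _ + X](_ : _ = 0) ?addr0 //.
rewrite -scalerBl /e -ha -hb -[RHS](scale0r (opX r (opX p (opD s (opD q w))))).
congr (_ *: _); apply/eqP; rewrite subr_eq0.
by case: (parity p); case: (parity q); case: (parity r); case: (parity s);
   rewrite /= !(expr0, expr1, mul1r, mulr1, mulrNN, mulN1r, mulrN1, opprK).
Qed.

(* The module E(g, S). *)
Definition Emod : slmod F m :=
  SlMod Eact_linearl Eact_linearr Eact_parity Eact_bracket.

End Exponential.

(* Main.v *)
Require Import Defs.
From HB Require Import structures.
From mathcomp Require Import all_boot all_order all_algebra.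
From mathcomp Require Import reals complex ssrcomplements mpoly.
Set Implicit Arguments.
Unset Strict Implicit.
Unset Printing Implicit Defensive.
Import GRing.Theory.
Local Open Scope ring_scope.

(** On either parity component of E(g, S), identified with the polynomial ring,
    h_i acts as the operator
      f |-> s_i x_i (f_i + f g_i) + t_i f,      s_i = 1 or -1, t_i a scalar,
    a subscript on f and g denoting the i-th partial derivative.  Everything
    is read off from this formula.

    (1) If g is the sum of the a_i x_i^(k_i), then h_i sends a monomial x^mu to
    a nonzero multiple of x^(mu + k_i e_i) plus a multiple of x^mu.  Writing
    each exponent uniquely as r + k nu with 0 <= r_i < k_i, this says that
    h^nu x^r is a nonzero multiple of x^(r + k nu) plus a combination of the
    x^(r + k nu') with nu' strictly below nu.  Hence the prod k_i monomials
    x^r form a basis over U(h): they span by induction on nu ([stair_span]),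
    and in a nontrivial relation a coefficient of largest degree, say at
    h^nu x^r, contributes an x^(r + k nu) that nothing else can cancel
    ([stair_indep]).

    (2) If g is a scalar multiple of x^l, then x_i g_i = l_i g for all i, so
    h_i - t_i sends the constant 1 to s_i l_i g.  Two of these multiples of g
    are linearly dependent, so for m >= 2 a nonzero polynomial of degree 1 in
    two of the h_i kills 1 ([monomial_torsion]), whereas a free module over the
    domain U(h) has no torsion ([uh_free_torsionfree]). *)

(** * Monomials *)

Lemma mnm_ind (m : nat) (P : 'X_{1..m} -> Prop) :
  P 0%MM -> (forall i nu, P nu -> P (U_(i) + nu)%MM) -> forall nu, P nu.
Proof.
move=> P0 PS nu; have [n] := ubnP (mdeg nu); elim: n nu => // n IH nu le_n.
have [->//|nz] := eqVneq nu 0%MM.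
have [i ni] : exists i, (0 < nu i)%N.
  apply/existsP; apply: contraNT nz; rewrite negb_exists => /forallP h.
  by apply/eqP/mnmP => i; rewrite mnm0E; apply/eqP; rewrite -leqn0 leqNgt h.
have le1 : (U_(i) <= nu)%MM.
  by apply/mnm_lepP => j; rewrite mnm1E; case: eqP => // <-.
rewrite -(submK le1) addmC; apply: PS; apply: IH.
by move: le_n; rewrite -{1}(submK le1) mdegD mdeg1 addn1.
Qed.

(** * The action of U(h) on a module *)

Section CartanAction.
Context {F : fieldType} {m : nat} (M : slmod F m).
Local Notation V := (mod0 M * mod1 M)%type.

HB.instance Definition _ u :=
  GRing.isLinear.Build F V V *:%R (@act F m M u) (@act_linearr F m M u).

Lemma hmx_diag (l : 'I_m) :
  hmx l = diag_mx (\row_p ((p == ix l)%:R + (p == bar)%:R)) :> 'M[F]_(m + 1).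
Proof.
apply/matrixP => p q; rewrite !mxE.
case: (eqVneq p q) => [->|pq]; rewrite ?andbb ?mulr1n // mulr0n.
have off r : (p == r) && (q == r) = false.
  by apply: contraNF pq => /andP[/eqP -> /eqP ->].
by rewrite !off addr0.
Qed.

Lemma hmx_homog (i : 'I_m) : is_homog false (hmx i : 'M[F]_(m + 1)).
Proof.
move=> p q; rewrite hmx_diag !mxE.
by case: (eqVneq p q) => [->|_]; rewrite ?addbb // mulr0n eqxx.
Qed.

Lemma hmxC (i j : 'I_m) :
  hmx i *m hmx j = hmx j *m hmx i :> 'M[F]_(m + 1).
Proof.
rewrite !hmx_diag !mulmx_diag; congr diag_mx.
by apply/rowP => p; rewrite !mxE mulrC.
Qed.

Lemma act_slhC i j x :
  act (s := M) (slh i) (act (slh j) x) = act (slh j) (act (slh i) x).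
Proof.
have hh l : is_homog false (vsval (slh l : subvs_of (sl F m))).
  by rewrite slhE; apply: hmx_homog.
have := act_bracket x (hh i) (hh j).
have -> : slbr (slh i) (slh j) = 0 *: (0 : subvs_of (sl F m)) + 0.
  apply: val_inj; rewrite /= slbrE (sbracket_homog (hh i) (hh j)) !slhE hmxC.
  by rewrite scale1r subrr scale0r addr0.
rewrite act_linearl scale0r add0r expr0 scale1r.
have -> : act 0 x = 0 :> V.
  apply: (addIr (act 0 x)); rewrite -{2}[act 0 x]scale1r addrC.
  by rewrite -act_linearl scaler0 addr0 add0r.
by move/eqP; rewrite eq_sym subr_eq0 => /eqP.
Qed.

(** The monomial h^mu of U(h), in the order of factors that [uh_act] uses. *)
Definition hpow (mu : 'X_{1..m}) (x : V) : V :=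
  foldr (fun i y => iter (mu i) (act (slh i)) y) x (enum 'I_m).

Lemma hpow_linear mu : linear (hpow mu).
Proof.
rewrite /hpow => c x y; elim: (enum _) => //= i s ->.
by elim: (mu i) => //= n ->; rewrite linearP.
Qed.
HB.instance Definition _ mu :=
  GRing.isLinear.Build F V V *:%R (hpow mu) (hpow_linear mu).

Lemma hpow0 x : hpow 0%MM x = x.
Proof. by rewrite /hpow; elim: (enum _) => //= i s ->; rewrite mnm0E. Qed.

(** The commutation of the h_i moves the new factor to the front. *)
Lemma hpowS i mu x : hpow (U_(i) + mu)%MM x = act (slh i) (hpow mu x).
Proof.
rewrite /hpow; set f := fun _ _ => _; set g := fun _ _ => _.
have iterC j n y : iter n (act (slh j)) (act (s := M) (slh i) y)
                 = act (slh i) (iter n (act (slh j)) y).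
  by elim: n => //= n ->; rewrite act_slhC.
have H s : uniq s -> foldr f x s =
    if i \in s then act (slh i) (foldr g x s) else foldr g x s.
  elim: s => //= j s IH /andP[js us]; rewrite IH // in_cons /f /g mnmDE mnm1E.
  case: (eqVneq i j) js => [->|ij] /negbTE js; first by rewrite js.
  by case: (i \in s); rewrite //= iterC.
by rewrite H ?enum_uniq // mem_enum.
Qed.

(** Summing over all exponents of bounded degree instead of the support of [p]
    makes [uh_act] visibly linear in [p]. *)
Lemma uh_actE d (p : {mpoly F[m]}) (x : V) : (msize p <= d)%N ->
  uh_act p x = \sum_(mu : 'X_{1..m < d}) p@_mu *: hpow mu x.
Proof.
move=> le_pd; set I : subFinType _ := 'X_{1..m < d}.
rewrite /uh_act (big_mksub I) ?msupp_uniq //=; first last.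
  by move=> mu /msize_mdeg_lt /leq_trans; apply.
by rewrite big_rmcond //= => mu /memN_msupp_eq0 ->; rewrite scale0r.
Qed.

Lemma uh_act_linearl c p q (x : V) :
  uh_act (c *: p + q) x = c *: uh_act p x + uh_act q x.
Proof.
pose d := maxn (msize (c *: p + q)) (maxn (msize p) (msize q)).
rewrite !(@uh_actE d) ?leq_max ?leqnn ?orbT // scaler_sumr -big_split /=.
by apply: eq_bigr => mu _; rewrite mcoeffD mcoeffZ scalerDl scalerA.
Qed.

Lemma uh_act_linearr p : linear (@uh_act F m M p).
Proof.
move=> c x y; rewrite !(uh_actE _ (leqnn _)) scaler_sumr -big_split /=.
by apply: eq_bigr => mu _; rewrite linearP scalerDr !scalerA mulrC.
Qed.
HB.instance Definition _ p :=
  GRing.isLinear.Build F V V *:%R (@uh_act F m M p) (@uh_act_linearr p).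

Lemma uh_act0 (x : V) : uh_act 0 x = 0.
Proof. by rewrite /uh_act msupp0 big_nil. Qed.

Lemma uh_actD p q (x : V) : uh_act (p + q) x = uh_act p x + uh_act q x.
Proof. by rewrite -{1}[p]scale1r uh_act_linearl scale1r. Qed.

Lemma uh_actZ c p (x : V) : uh_act (c *: p) x = c *: uh_act p x.
Proof. by rewrite -[c *: p]addr0 uh_act_linearl uh_act0 addr0. Qed.

Lemma uh_act_sum (I : Type) (r : seq I) (P : pred I) (f : I -> {mpoly F[m]})
    (x : V) :
  uh_act (\sum_(i <- r | P i) f i) x = \sum_(i <- r | P i) uh_act (f i) x.
Proof.
have actD p q := uh_actD p q x.
exact: (big_morph (fun p => uh_act p x) actD (uh_act0 x)).
Qed.

Lemma uh_actX mu (x : V) : uh_act 'X_[mu] x = hpow mu x.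
Proof. by rewrite /uh_act msuppX big_seq1 mcoeffX eqxx scale1r. Qed.

Lemma uh_act1 (x : V) : uh_act 1 x = x.
Proof. by rewrite -mpolyX0 uh_actX hpow0. Qed.

Lemma uh_actMX i p (x : V) : uh_act ('X_i * p) x = act (slh i) (uh_act p x).
Proof.
rewrite [p]mpolyE mulr_sumr !uh_act_sum linear_sum; apply: eq_bigr => mu _.
by rewrite -scalerAr !uh_actZ linearZ -mpolyXD !uh_actX hpowS.
Qed.

Lemma uh_actM p q (x : V) : uh_act (p * q) x = uh_act p (uh_act q x).
Proof.
rewrite [p]mpolyE mulr_suml !uh_act_sum; apply: eq_bigr => mu _.
rewrite -scalerAl !uh_actZ uh_actX; congr (_ *: _).
elim/mnm_ind: mu => [|i mu IH]; first by rewrite mpolyX0 mul1r hpow0.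
by rewrite mpolyXD -mulrA uh_actMX IH hpowS.
Qed.

(** The coordinates of [q x] in a basis are [q] times those of [x], and
    polynomials over a field form a domain. *)
Lemma uh_free_torsionfree b n (q : {mpoly F[m]}) (x : V) :
  uh_free M b n -> q != 0 -> in_part b x -> uh_act q x = 0 -> x = 0.
Proof.
move=> [e [eb he]] qn0 xb qx0.
have [c [xE _]] := he x xb.
have b0 : in_part b (0 : V) by case: (b).
have [d [_ dU]] := he 0 b0.
have d0 : d = [ffun=> 0].
  by apply: dU; rewrite big1 // => j _; rewrite ffunE uh_act0.
have : d = [ffun j => q * c j].
  apply: dU; rewrite -[LHS]qx0 xE linear_sum; apply: eq_bigr => j _.
  by rewrite ffunE uh_actM.
rewrite d0 => /ffunP h; rewrite xE big1 // => j _.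
have := h j; rewrite !ffunE => /esym/eqP.
rewrite mulf_eq0 (negbTE qn0) => /eqP ->.
exact: uh_act0.
Qed.

Definition uh_span (I : finType) (e : I -> V) (x : V) : Prop :=
  exists c : I -> {mpoly F[m]}, x = \sum_j uh_act (c j) (e j).

Section Span.
Variables (I : finType) (e : I -> V).

Lemma uh_span_basis j : uh_span e (e j).
Proof.
exists (fun i => (i == j)%:R).
rewrite (bigD1 j) //= eqxx uh_act1 big1 ?addr0 //.
by move=> i /negbTE ->; rewrite uh_act0.
Qed.

Lemma uh_span_linear c x y :
  uh_span e x -> uh_span e y -> uh_span e (c *: x + y).
Proof.
move=> [p ->] [q ->]; exists (fun j => c *: p j + q j).
rewrite scaler_sumr -big_split.
by apply: eq_bigr => j _; rewrite uh_act_linearl.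
Qed.

Lemma uh_span_act i x : uh_span e x -> uh_span e (act (slh i) x).
Proof.
move=> [p ->]; exists (fun j => 'X_i * p j).
by rewrite linear_sum; apply: eq_bigr => j _; rewrite uh_actMX.
Qed.

(** Existence and uniqueness of coordinates split into span and independence;
    any index type of the right cardinality will do. *)
Lemma uh_free_basis b n :
  #|I| = n -> (forall j, in_part b (e j)) ->
  (forall x, in_part b x -> uh_span e x) ->
  (forall c : I -> {mpoly F[m]},
     \sum_j uh_act (c j) (e j) = 0 -> forall j, c j = 0) ->
  uh_free M b n.
Proof.
move=> <- eb span indep; exists (fun j => e (enum_val j)); split=> // x xb.
have reindexE (c : I -> {mpoly F[m]}) :
    \sum_j uh_act (c j) (e j)
    = \sum_(j < #|I|) uh_act (c (enum_val j)) (e (enum_val j)).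
  by rewrite (reindex _ (onW_bij _ (@enum_val_bij I))) /=.
have [c xE] := span x xb; exists [ffun j => c (enum_val j)]; split.
  by rewrite xE reindexE; apply: eq_bigr => j _; rewrite ffunE.
move=> d xE'; apply/ffunP => j; rewrite ffunE.
pose d' i := d (enum_rank i).
have z : \sum_i uh_act ((-1) *: d' i + c i) (e i) = 0.
  under eq_bigr do rewrite uh_act_linearl.
  rewrite big_split -scaler_sumr /= -xE (reindexE d') xE'.
  rewrite scaleN1r addrC; apply/eqP; rewrite subr_eq0; apply/eqP.
  by apply: eq_bigr => i _; rewrite /d' enum_valK.
move: (indep _ z (enum_val j)) => /eqP.
by rewrite scaleN1r addrC subr_eq0 /d' enum_valK => /eqP.
Qed.

End Span.
End CartanAction.

(** * The Cartan elements as differential operators *)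

Section Euler.
Context {F : fieldType} {m : nat}.

Lemma euler_mpolyX i (mu : 'X_{1..m}) :
  'X_i * ('X_[mu])^`M(i) = (mu i)%:R *: 'X_[mu] :> {mpoly F[m]}.
Proof.
rewrite mderivX -scalerAr; have [->|mui] := eqVneq (mu i) 0%N.
  by rewrite !scale0r.
by rewrite -mpolyXD addmC submK // lep1mP.
Qed.

Lemma mcoeff_euler i (p : {mpoly F[m]}) mu :
  ('X_i * p^`M(i))@_mu = (mu i)%:R * p@_mu.
Proof.
rewrite [p in LHS]mpolyE [p in RHS]mpolyE !linear_sum mulr_sumr linear_sum.
rewrite mulr_sumr; apply: eq_bigr => nu _ /=.
rewrite mderivZ -scalerAr euler_mpolyX !mcoeffZ mcoeffX mulrCA.
by case: eqP => [->|]; rewrite ?mulr0.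
Qed.

End Euler.

Section Exponential.
Context {F : fieldType} {m : nat} (g : {mpoly F[m]}) (S : {set 'I_m}).
Local Notation E := ({mpoly F[m]} * {mpoly F[m]})%type.

(** The coordinates of h_i in the basis used by [Eact] are its matrix entries,
    and [hmx i] is diagonal with a single nonzero entry outside [bar]. *)
Lemma act_slhE i (w : E) : act (s := Emod g S) (slh i) w = Eh g S i w.
Proof.
have bar_ix (j : 'I_m) : (bar == ix j) = false.
  by rewrite eq_sym -[LHS]/(parity (ix j)) parity_ix.
have ix_bar (j : 'I_m) : (ix j == bar) = false by rewrite eq_sym bar_ix.
have ix_ix (j l : 'I_m) : (ix j == ix l) = (j == l) by rewrite /ix eq_lshift.
rewrite /act /= /Eact slhE hmx_diag.
have off p q (pq : (p == q) = false) :
    diag_mx (\row_r ((r == ix i)%:R + (r == bar)%:R)) p q = 0 :> F.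
  by rewrite !mxE pq mulr0n.
rewrite [X in _ + X]big1 => [|j _]; last by rewrite off ?bar_ix // scale0r.
rewrite [X in _ + X + _]big1 => [|j _]; last by rewrite off ?ix_bar // scale0r.
rewrite [X in _ + X + _ + _]big1 => [|j _]; last first.
  by apply: big1 => l lj; rewrite off ?scale0r // ix_ix eq_sym (negbTE lj).
rewrite (bigD1 i) //= big1 => [|j ji]; last first.
  by rewrite !mxE !ix_bar !ix_ix (negbTE ji) addr0 mul0rn scale0r.
by rewrite !mxE !eqxx ix_bar !addr0 mulr1n scale1r.
Qed.

Definition cartan_sign (i : 'I_m) : F := (-1) ^+ (i \in S).
Definition cartan_shift (b : bool) (i : 'I_m) : F := b%:R - (i \in S)%:R.

Lemma cartan_sign_neq0 i : cartan_sign i != 0.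
Proof. by rewrite /cartan_sign signr_eq0. Qed.

(** The operator by which h_i acts on the component of parity [b]: the term -1
    of the formula for i in S and the term xi d/dxi, which is [b] on that
    component, are collected in the shift. *)
Definition cartan_op (b : bool) (i : 'I_m) (f : {mpoly F[m]}) : {mpoly F[m]} :=
  cartan_sign i *: ('X_i * (f^`M(i) + f * g^`M(i))) + cartan_shift b i *: f.

Definition emb (b : bool) (f : {mpoly F[m]}) : E :=
  if b then (0, f) else (f, 0).
Definition proj (b : bool) (w : E) : {mpoly F[m]} := if b then w.2 else w.1.

Lemma proj_linear b : linear (proj b).
Proof. by case: b => c x y. Qed.
HB.instance Definition _ b :=
  GRing.isLinear.Build F E {mpoly F[m]} *:%R (proj b) (proj_linear b).

Lemma emb_linear b : linear (emb b).
Proof. by case: b => c x y; apply: pairE; rewrite /= ?scaler0 ?addr0. Qed.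
HB.instance Definition _ b :=
  GRing.isLinear.Build F {mpoly F[m]} E *:%R (emb b) (emb_linear b).

Lemma embK b : cancel (emb b) (proj b). Proof. by case: b. Qed.

Lemma in_part_emb b f : in_part b (emb b f). Proof. by case: b. Qed.

Lemma in_part_projK b (w : E) : in_part b w -> emb b (proj b w) = w.
Proof. by case: b w => -[x y] /= ->. Qed.

Lemma proj_act b i (w : E) :
  proj b (act (s := Emod g S) (slh i) w) = cartan_op b i (proj b w).
Proof.
rewrite act_slhE /Eh /cartan_op /cartan_sign /cartan_shift.
case: (i \in S); case: b; case: w => x y /=;
  rewrite ?expr0 ?expr1 ?scale1r ?scaleN1r ?subrr ?subr0 ?sub0r ?addr0
    ?scale0r ?addr0 ?scale1r ?scaleN1r //.
by rewrite addrNK.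
Qed.

Lemma act_emb b i f :
  act (s := Emod g S) (slh i) (emb b f) = emb b (cartan_op b i f).
Proof.
rewrite -{2}[f](embK b) -proj_act in_part_projK //.
have h : is_homog false (vsval (slh i : subvs_of (sl F m))).
  by rewrite slhE; apply: hmx_homog.
exact: (act_parity (s := Emod g S) h (in_part_emb b f)).
Qed.

End Exponential.

(** * Torsion for a monomial exponent *)

Section Monomial.
Context {F : fieldType} {m : nat} (alpha : F) (l : 'X_{1..m}) (S : {set 'I_m}).
Let g : {mpoly F[m]} := alpha *: 'X_[l].

(** Since x_i g_i = l_i g, the elements h_i - t_i and h_j - t_j send 1 to
    multiples of the same polynomial g. *)
Lemma monomial_torsion (i j : 'I_m) : i != j ->
  [pchar F] =i pred0 ->
  exists2 q : {mpoly F[m]}, q != 0 &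
    uh_act (M := Emod g S) q (1, 0) = 0.
Proof.
move=> ij charF.
(* (l_j, - l_i) is a relation, and if l_i = 0, which could make it trivial,
   then (1, 0) is one too. *)
have [s [t [st0 sl_tl]]] : exists s t : F,
    ((s != 0) || (t != 0)) /\ s * (l i)%:R + t * (l j)%:R = 0.
  have [li0|li0] := eqVneq (l i) 0%N.
    by exists 1, 0; rewrite oner_eq0 li0 mulr0 mul0r addr0.
  exists (l j)%:R, (- (l i)%:R); split; last by rewrite mulNr mulrC subrr.
  by rewrite oppr_eq0 ((pcharf0P F).1 charF (l i)) li0 orbT.
pose T n : {mpoly F[m]} :=
  cartan_sign S n *: ('X_n - cartan_shift S false n *: 1).
have T1 n : uh_act (M := Emod g S) (T n) (1, 0) = emb false ((l n)%:R *: g).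
  have e1 : ((1, 0) : mod0 (Emod g S) * mod1 (Emod g S)) = emb false 1 by [].
  rewrite uh_actZ uh_actD -scaleN1r !uh_actZ uh_act1.
  rewrite -['X_n]mulr1 uh_actMX uh_act1 e1 act_emb.
  transitivity (emb false (cartan_sign S n *: (cartan_op g S false n 1
                  + -1 *: (cartan_shift S false n *: 1)))).
    by apply: pairE; rewrite /= ?scaler0 ?addr0 ?scaler0.
  congr (emb _ _).
  rewrite /cartan_op mderivC add0r mul1r scalerA mulN1r scaleNr addrK scalerA.
  rewrite -expr2 sqrr_sign scale1r /g mderivZ -scalerAr euler_mpolyX.
  by rewrite !scalerA mulrC.
exists (s *: T i + t *: T j); last first.
  rewrite uh_act_linearl (uh_actZ t) !T1.
  transitivity (emb false (s *: ((l i)%:R *: g) + t *: ((l j)%:R *: g))).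
    by apply: pairE; rewrite /= ?scaler0 ?addr0.
  by rewrite (scalerA s) (scalerA t) -scalerDl sl_tl scale0r linear0.
(* The coefficients of degree one show that the combination is nonzero. *)
have coefT n o : (T n)@_(U_(o)) = cartan_sign S n * (n == o)%:R.
  rewrite mcoeffZ mcoeffB mcoeffZ mcoeff1 mcoeffX eq_mnm1.
  by rewrite -mdeg_eq0 mdeg1 mulr0 subr0.
apply: contraL st0 => /eqP q0; rewrite negb_or !negbK.
have := congr1 (mcoeff U_(j)) q0; have := congr1 (mcoeff U_(i)) q0.
rewrite !mcoeffD !(mcoeffZ s) !(mcoeffZ t) !coefT !mcoeff0 !eqxx.
rewrite (eq_sym j i) (negbTE ij).
rewrite !mulr0 addr0 add0r !mulr1 => /eqP + /eqP.
by rewrite !mulf_eq0 !(negbTE (cartan_sign_neq0 _ _)) !orbF => -> ->.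
Qed.

End Monomial.

(** * A basis for a sum of pure powers *)

Section Staircase.
Context {F : fieldType} {m : nat} (S : {set 'I_m}) (a : 'I_m -> F).
Variable k : 'I_m -> nat.
Hypothesis k_gt0 : forall i, (0 < k i)%N.
Hypothesis ak_neq0 : forall i, a i * (k i)%:R != 0.

Let g : {mpoly F[m]} := \sum_(i < m) a i *: 'X_i ^+ k i.
Let I := fprod (fun i => 'I_(k i)).

Definition stair (r : I) (nu : 'X_{1..m}) : 'X_{1..m} :=
  [multinom (r i + k i * nu i)%N | i < m].

Lemma stair_inj r r' nu nu' : stair r nu = stair r' nu' -> r = r' /\ nu = nu'.
Proof.
move=> /mnmP e; suff h i : r i = r' i :> nat /\ nu i = nu' i.
  by split; [apply/fprodP => i; apply/val_inj; apply: (h i).1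
            |apply/mnmP => i; apply: (h i).2].
have := e i; rewrite !mnmE => ei.
have := congr1 (modn^~ (k i)) ei; have := congr1 (divn^~ (k i)) ei.
rewrite /= !(addnC (_ (r i))) !(addnC (r' i)) !(mulnC (k i)).
by rewrite !modnMDl !modn_small // !divnMDl // !divn_small // !addn0.
Qed.

Lemma stair_surj mu : exists r nu, mu = stair r nu.
Proof.
exists [fprod i => Ordinal (ltn_pmod (mu i) (k_gt0 i))].
exists [multinom (mu i %/ k i)%N | i < m].
by apply/mnmP => i; rewrite !mnmE fprodE /= addnC mulnC -divn_eq.
Qed.

Lemma stairS r i nu : stair r (U_(i) + nu) = (U_(i) *+ k i + stair r nu)%MM.
Proof.
apply/mnmP => j; rewrite mnmDE mulmnE !mnmE mulnDr addnCA.
by case: eqP => [->|_]; rewrite ?muln1 ?muln0 ?mul1n ?mul0n.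
Qed.

Lemma euler_g i : 'X_i * g^`M(i) = (a i * (k i)%:R) *: 'X_[U_(i) *+ k i].
Proof.
rewrite /g linear_sum mulr_sumr (bigD1 i) //= big1 ?addr0.
  rewrite mderivZ -scalerAr mpolyXn euler_mpolyX mulmnE mnm1E eqxx mul1n.
  by rewrite scalerA.
move=> j ji; rewrite mderivZ -scalerAr mpolyXn euler_mpolyX mulmnE mnm1E.
by rewrite (negbTE ji) mul0n scale0r scaler0.
Qed.

Definition step (i : 'I_m) : F := cartan_sign S i * (a i * (k i)%:R).
Definition diagonal b (i : 'I_m) (mu : 'X_{1..m}) : F :=
  cartan_sign S i * (mu i)%:R + cartan_shift S b i.

Lemma step_neq0 i : step i != 0.
Proof. by rewrite mulf_neq0 ?cartan_sign_neq0 ?ak_neq0. Qed.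

Lemma mcoeff_cartan_op b i f mu :
  (cartan_op g S b i f)@_mu
  = step i * (f * 'X_[U_(i) *+ k i])@_mu + diagonal b i mu * f@_mu.
Proof.
rewrite /cartan_op mulrDr mulrCA euler_g -scalerAr.
rewrite mcoeffD !mcoeffZ mcoeffD mcoeffZ mcoeff_euler.
rewrite mulrDr [_ * _ + _ * _ in LHS]addrC -addrA; congr (_ + _).
  by rewrite mulrA.
by rewrite [RHS]mulrDl -mulrA.
Qed.

Lemma cartan_op_mpolyX b i mu :
  cartan_op g S b i 'X_[mu]
  = step i *: 'X_[U_(i) *+ k i + mu] + diagonal b i mu *: 'X_[mu].
Proof.
apply/mpolyP => nu; rewrite mcoeff_cartan_op -mpolyXD addmC mcoeffD !mcoeffZ.
by rewrite (mcoeffX F mu nu); case: eqP => [->|]; rewrite ?mulr0.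
Qed.

(** The triangularity of h^nu x^r: its exponents lie in the class of [r] modulo
    [k], at levels at most [nu], and the top level occurs. *)
Definition stair_lead r nu (f : {mpoly F[m]}) : Prop :=
  f@_(stair r nu) != 0 /\
  forall mu, f@_mu != 0 -> exists2 nu', (nu' <= nu)%MM & mu = stair r nu'.

(** The first term of [mcoeff_cartan_op] raises all levels by e_i, and the
    diagonal term keeps them, hence cannot reach the new top level. *)
Lemma stair_lead_op b i r nu f :
  stair_lead r nu f -> stair_lead r (U_(i) + nu) (cartan_op g S b i f).
Proof.
move=> [f_lead f_supp]; split=> [|mu].
  rewrite mcoeff_cartan_op {1}stairS mcoeffMX.
  have [->|/f_supp [nu' le_nu' /stair_inj [_ e]]] :=
    eqVneq f@_(stair r (U_(i) + nu)) 0.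
    by rewrite mulr0 addr0 mulf_neq0 ?step_neq0.
  move: le_nu'; rewrite -e => /mnm_lepP /(_ i).
  by rewrite mnmDE mnm1E eqxx add1n ltnn.
rewrite mcoeff_cartan_op; have [->|/f_supp [nu' le_nu' ->]] := eqVneq f@_mu 0.
  rewrite mulr0 addr0 mulf_eq0 negb_or => /andP[_]; rewrite -mcoeff_msupp.
  rewrite (perm_mem (msuppMX _ _)) => /mapP [mu' + ->].
  rewrite mcoeff_msupp => /f_supp [nu' le_nu' ->].
  exists (U_(i) + nu')%MM; last by rewrite stairS.
  by apply/mnm_lepP => j; rewrite !mnmDE leq_add2l; apply/mnm_lepP.
by move=> _; exists nu' => //; apply: (lepm_trans le_nu'); apply: lem_addl.
Qed.

Lemma stair_lead_hpow b r nu :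
  stair_lead r nu (proj b (hpow (M := Emod g S) nu (emb b 'X_[stair r 0%MM]))).
Proof.
elim/mnm_ind: nu => [|i nu IH].
  2: by rewrite hpowS proj_act; apply: stair_lead_op.
rewrite hpow0 embK; split=> [|mu]; first by rewrite mcoeffX eqxx oner_eq0.
rewrite mcoeffX.
case: (eqVneq (stair r 0) mu) => [<- _|_]; last by rewrite eqxx.
by exists 0%MM; rewrite ?lepm_refl.
Qed.

Let basis b (r : I) : mod0 (Emod g S) * mod1 (Emod g S) :=
  emb b 'X_[stair r 0%MM].

(** The equation for h_i x^mu is solved for x^(mu + k_i e_i), whose coefficient
    is nonzero: the span contains x^(r + k nu) for all nu, by induction. *)
Lemma stair_span b x : in_part b x -> uh_span (M := Emod g S) (basis b) x.
Proof.
move=> xb; rewrite -(in_part_projK xb); set f := proj b x.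
have span0 : uh_span (M := Emod g S) (basis b) 0.
  by exists (fun=> 0); rewrite big1 // => r _; rewrite uh_act0.
suff monom mu : uh_span (M := Emod g S) (basis b) (emb b 'X_[mu]).
  rewrite [f]mpolyE linear_sum.
  apply: (big_ind (uh_span (M := Emod g S) (basis b))) => //.
    by move=> y z hy hz; have := uh_span_linear 1 hy hz; rewrite scale1r.
  move=> mu _; rewrite linearZ; have := uh_span_linear f@_mu (monom mu) span0.
  by rewrite addr0.
have [r [nu ->]] := stair_surj mu.
elim/mnm_ind: nu => [|i nu IH]; first exact: uh_span_basis.
have IHi := uh_span_linear (- diagonal b i (stair r nu)) IH (uh_span_act i IH).
have := uh_span_linear (step i)^-1 IHi span0.
rewrite addr0 act_emb cartan_op_mpolyX -stairS.
set d := diagonal b i _; set X := 'X_[stair r nu]; set Y := 'X_[_].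
suff -> : emb b Y
  = (step i)^-1 *: (- d *: emb b X + emb b (step i *: Y + d *: X)) by [].
transitivity (emb b ((step i)^-1 *: (- d *: X + (step i *: Y + d *: X)))).
  by rewrite scaleNr addrCA addNr addr0 scalerA mulVf ?step_neq0 ?scale1r.
by case: (b); apply: pairE; rewrite /= ?scaler0 ?addr0 ?scaler0.
Qed.

(** Take a coefficient polynomial [c r] of largest degree and its leading
    exponent [nu].  By [stair_lead], a term h^nu' x^r' contains x^(r + k nu)
    only if r' = r and nu <= nu'; the choice of [c r] bounds the degree of nu'
    by that of nu, so nu' = nu and this single term would have to vanish. *)
Lemma stair_indep b (c : I -> {mpoly F[m]}) :
  \sum_r uh_act (c r) (basis b r) = 0 -> forall r, c r = 0.
Proof.
move=> c0 r0; apply/eqP; apply: contraT => cr0.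
have [r _ r_max] := @arg_maxnP I r0 predT (fun r => msize (c r)) isT.
have cr : c r != 0.
  apply: contraNneq cr0 => cr; rewrite -msize_poly_eq0 -leqn0.
  by rewrite -(msize0 m F) -cr; apply: r_max.
pose nu := mlead (c r).
have nu_supp : nu \in msupp (c r) by apply: mlead_supp.
pose coef r' nu' :=
  (proj b (hpow (M := Emod g S) nu' (basis b r')))@_(stair r nu).
have coef0 r' nu' : nu' \in msupp (c r') -> (r', nu') != (r, nu) ->
    coef r' nu' = 0.
  move=> nu'_supp; apply: contraNeq => /(stair_lead_hpow b r' nu').2.
  move=> [nu'' le_nu /stair_inj [er en]]; subst nu''.
  rewrite xpair_eqE -er eqxx /=; have := submK le_nu.
  have -> : (nu' - nu = 0)%MM.
    apply/eqP; rewrite -mdeg_eq0 -leqn0 -(leq_add2r (mdeg nu)) -mdegD submK //.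
    rewrite add0n -ltnS (mlead_deg cr) (leq_trans (msize_mdeg_lt nu'_supp)) //.
    exact: r_max.
  by rewrite add0m => ->.
have sum0 : \sum_r' \sum_(nu' <- msupp (c r')) (c r')@_nu' * coef r' nu' = 0.
  have := congr1 (fun x => (proj b x)@_(stair r nu)) c0.
  rewrite !linear_sum linear0 mcoeff0 => e; rewrite -[RHS]e.
  apply: eq_bigr => r' _.
  rewrite /uh_act !linear_sum; apply: eq_bigr => nu' _ /=.
  by rewrite linearZ mcoeffZ.
move: sum0; rewrite (bigD1 r) //= [X in _ + X]big1 ?addr0; last first.
  move=> r' ne; rewrite big_seq big1 // => nu' nu'_supp.
  by rewrite coef0 ?mulr0 // xpair_eqE (negbTE ne).
rewrite (bigD1_seq nu) ?msupp_uniq //= big_seq_cond big1 ?addr0; last first.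
  move=> nu' /andP[nu'_supp ne].
  by rewrite coef0 ?mulr0 // xpair_eqE (negbTE ne) andbF.
move/eqP; rewrite mulf_eq0 mleadc_eq0 (negbTE cr) /=.
by rewrite (negbTE (stair_lead_hpow b r nu).1).
Qed.

Theorem uh_free_stair b : uh_free (Emod g S) b (\prod_(i < m) k i).
Proof.
apply: (@uh_free_basis _ _ (Emod g S) I (basis b)).
- by rewrite card_fprod; apply: eq_bigr => i _; rewrite card_ord.
- by move=> r; apply: in_part_emb.
- exact: stair_span.
- exact: stair_indep.
Qed.

End Staircase.

Theorem lemma4p6 (R : realType) (m : nat) (hm : (1 <= m)%N) (S : {set 'I_m})
    (alpha : R[i]) (a : 'I_m -> R[i]) (k : 'I_m -> nat)
    (halpha : alpha != 0) (ha : forall i, a i != 0)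
    (hk : forall i, (1 <= k i)%N) :
  inMsl (\prod_(i < m) k i)%N
    (Emod (\sum_(i < m) a i *: ('X_i : {mpoly R[i][m]}) ^+ k i) S)
  /\ ((2 <= m)%N ->
      forall (l : 'I_m -> nat) (p : nat), (1 <= p)%N ->
        ~ inMsl p
            (Emod (alpha *: \prod_(i < m) ('X_i : {mpoly R[i][m]}) ^+ l i) S)).
Proof.
have charF : [pchar R[i]] =i pred0 by apply: Num.Theory.pchar_num.
split.
  have ak i : a i * (k i)%:R != 0.
    by rewrite mulf_neq0 ?ha // ((pcharf0P _).1 charF) -lt0n hk.
  by split; apply: uh_free_stair.
move=> m_ge2 l p _ [free _].
pose i0 : 'I_m := Ordinal (ltnW m_ge2); pose i1 : 'I_m := Ordinal m_ge2.
pose mu := [multinom l i | i < m].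
have mon : \prod_(i < m) ('X_i : {mpoly R[i][m]}) ^+ l i = 'X_[mu].
  by rewrite mpolyXE_id; apply: eq_bigr => i _; rewrite mnmE.
rewrite mon in free.
have [q q0 qx] := monomial_torsion alpha mu S (isT : i0 != i1) charF.
have := uh_free_torsionfree free q0 (erefl : in_part false (1, 0)) qx.
move/(congr1 (fun w => w.1)) => /= /eqP.
by rewrite oner_eq0.
Qed.
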